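(* Write $n=n_x$. Assume that $f$ is bounded below by $f_{\mathrm{low}}\in\mathbb{R}$, that $|f(x,y)-f(x,y')|\le L_f\|y-y'\|$ for all $x\in\mathbb{R}^{n}$, $y,y'\in\mathbb{R}^{n_y}$ with $L_f>0$ independent of $x$, and that $F$ is continuously differentiable with $L$-Lipschitz continuous gradient. Let $\{x_k\}$ be a sequence generated by the inexact directional direct-search algorithm described in the context, where for some $\kappa>0$ the set $D_k$ satisfies $\mathrm{cm}(D_k)\ge\kappa$ for every $k\in\mathbb{N}_0$. Let $\epsilon>0$ be a fixed precision and assume also that the oracle accuracy satisfies $\varepsilon\le\epsilon^2\kappa^2$, that at every iteration there are at most $d_1n$ function evaluations, and that $\kappa\ge d_2/\sqrt n$, for $d_1,d_2>0$. Then, if $\alpha_{\min}=2\sqrt{\frac{L_f\varepsilon}{L+c}}$, the algorithm terminates after $\mathcal{O}(n^2/\epsilon^2)$ function evaluations with last iterate $x_{\bar k}$ satisfying $\|\nabla F(x_{\bar k})\|\le d_3\epsilon$, for $d_3>0$ depending only on $c$, $L$ and $L_f$.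
   Context: Bilevel setting. $f:\mathbb{R}^{n_x}\times\mathbb{R}^{n_y}\to\mathbb{R}$ is continuous, $g:\mathbb{R}^{n_x}\times\mathbb{R}^{n_y}\to\mathbb{R}$, $Z\subset\mathbb{R}^{n_y}$. For every $x\in\mathbb{R}^{n_x}$, $\arg\min_{z\in Z} g(x,z)=\{y(x)\}$ is a singleton. The true objective is $F(x):=f(x,y(x))$. A fixed oracle $\tilde y:\mathbb{R}^{n_x}\to\mathbb{R}^{n_y}$ satisfies $\|\tilde y(x)-y(x)\|\le\varepsilon$ for all $x$, where $\varepsilon>0$ is a fixed constant (the oracle accuracy, distinct from the precision $\epsilon$), and $\tilde F(x):=f(x,\tilde y(x))$. A function evaluation is an evaluation of $\tilde F$ at a point. Cosine measure: $\mathrm{cm}(D)=\min_{v\ne0}\max_{d\in D}\frac{d^\top v}{\|d\|\|v\|}$. Inexact directional direct-search algorithm. Parameters: $x_0\in\mathbb{R}^{n_x}$, stepsize lower bound $\alpha_{\min}>0$, initial stepsize $\alpha_0\ge\alpha_{\min}$, contraction factor $\theta\in(0,1)$, expansion factor $\gamma\ge1$, coefficient $c>0$. At each iteration $k=0,1,2,\dots$: (i) Search: choose an arbitrary finite set $S_k\subset\mathbb{R}^{n_x}$; if some $t\in S_k$ satisfies $\tilde F(t)<\tilde F(x_k)-\frac c2\alpha_k^2$, set $x_{k+1}=t$ for such a $t$, declare the iteration successful and skip the poll step. (ii) Poll: otherwise, choose a positive spanning set of directions $D_k\subset\mathbb{R}^{n_x}$; if some $d_k\in D_k$ satisfies $\tilde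 F(x_k+\alpha_kd_k)<\tilde F(x_k)-\frac c2\alpha_k^2$, set $x_{k+1}=x_k+\alpha_kd_k$ for such a $d_k$ and declare the iteration successful; otherwise set $x_{k+1}=x_k$ and declare it unsuccessful. (iii) Stepsize: if successful, choose any $\alpha_{k+1}\in[\alpha_k,\gamma\alpha_k]$; if unsuccessful, set $\alpha_{k+1}=\max\{\alpha_{\min},\theta\alpha_k\}$. (iv) Termination: the termination criterion is $\alpha_k=\alpha_{k+1}=\alpha_{\min}$; $x_{\bar k}$ denotes the last iterate.
   Formalization: Poll directions are assumed to be unit vectors; the stopping test α_k=α_{k+1}=α_min is applied only at unsuccessful iterations; and the constant in O(n²/ϵ²) may depend on a positive lower bound τ for ε/(ϵ²κ²). The literal claim fails without these. *)

(* Defs.v *)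
From HB Require Import structures.
From mathcomp Require Import all_boot all_order all_algebra.
From mathcomp Require Import all_classical all_reals all_analysis.

Set Implicit Arguments.
Unset Strict Implicit.
Unset Printing Implicit Defensive.

Import Order.TTheory GRing.Theory Num.Theory.
Import numFieldNormedType.Exports.

Local Open Scope classical_set_scope.
Local Open Scope ring_scope.

(* The library norm on 'rV[R]_n is the sup norm, so the Euclidean norm is
   defined separately.  Topology and Fréchet differentiability do not depend on
   this choice. *)
Definition dotv (R : realType) (n : nat) (u v : 'rV[R]_n) : R :=
  \sum_(i < n) u ord0 i * v ord0 i.

Definition enorm (R : realType) (n : nat) (u : 'rV[R]_n) : R :=
  Num.sqrt (dotv u u).

Definition grad (R : realType) (n : nat) (F : 'rV[R]_n -> R) (x : 'rV[R]_n) :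
  'rV[R]_n := \row_(i < n) 'D_(delta_mx ord0 i) F x.

Definition argmin (R : realType) (T : Type) (Z : set T) (h : T -> R) : set T :=
  [set z | Z z /\ forall z', Z z' -> h z <= h z'].

(* For a nonempty finite D in positive dimension the supremum and the infimum
   are attained, so they are the max and the min. *)
Definition cosine_measure (R : realType) (n : nat) (D : seq 'rV[R]_n) : R :=
  inf [set sup [set dotv d v / (enorm d * enorm v) | d in [set` D]]
      | v in [set v : 'rV[R]_n | v != 0]].

Definition positive_spanning (R : realType) (n : nat) (D : seq 'rV[R]_n) : Prop :=
  forall v : 'rV[R]_n, exists a : 'rV[R]_n -> R,
    (forall d, 0 <= a d) /\ v = \sum_(d <- D) a d *: d.

Record ds_params (R : realType) := DSParams {
  alpha_min : R;
  theta : R;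
  gamma : R;
  dcoef : R (* the coefficient c of the decrease condition *)
}.

(* Finite sets are represented by sequences.  [evals r k] lists, with
   repetitions, the points at which the inexact objective is evaluated during
   iteration k.  Values beyond the termination index, and values of [poll_dirs]
   at iterations that skip the poll step, are junk. *)
Record ds_run (R : realType) (n : nat) := DSRun {
  iterate : nat -> 'rV[R]_n;
  stepsize : nat -> R;
  search_set : nat -> seq 'rV[R]_n;
  poll_dirs : nat -> seq 'rV[R]_n;
  evals : nat -> seq 'rV[R]_n
}.

Section Algorithm.
Variables (R : realType) (n : nat) (p : ds_params R) (Ft : 'rV[R]_n -> R).
Variable r : ds_run R n.
Implicit Types (k : nat) (t d : 'rV[R]_n).

Definition decreases k t : bool :=
  Ft t < Ft (iterate r k) - dcoef p / 2 * stepsize r k ^+ 2.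

Definition trial k d : 'rV[R]_n := iterate r k + stepsize r k *: d.

Definition search_succeeds k : bool := has (decreases k) (search_set r k).

Definition poll_succeeds k : bool :=
  ~~ search_succeeds k && has (fun d => decreases k (trial k d)) (poll_dirs r k).

Definition unsuccessful k : bool := ~~ search_succeeds k && ~~ poll_succeeds k.

(* A trial point counts as tested only if it has been evaluated: an accepted
   point is always evaluated, and a step is declared a failure only after all
   of its points have been evaluated. *)
Definition search_step k : Prop :=
  [/\ search_succeeds k,
      iterate r k.+1 \in search_set r k,
      decreases k (iterate r k.+1)
    & iterate r k.+1 \in evals r k].

Definition poll_step k : Prop :=
  [/\ ~~ search_succeeds k,
      positive_spanning (poll_dirs r k),
      {subset search_set r k <= evals r k}
    & (exists d, [/\ d \in poll_dirs r k, decreases k (trial k d),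
                     iterate r k.+1 = trial k d & trial k d \in evals r k])
      \/ [/\ unsuccessful k, iterate r k.+1 = iterate r k
           & forall d, d \in poll_dirs r k -> trial k d \in evals r k]].

Definition stepsize_update k : Prop :=
  if unsuccessful k
  then stepsize r k.+1 = Num.max (alpha_min p) (theta p * stepsize r k)
  else stepsize r k <= stepsize r k.+1 <= gamma p * stepsize r k.

(* The termination criterion is tested at unsuccessful iterations only: a
   successful iteration may also leave the stepsize equal to alpha_min. *)
Definition terminates_at k : Prop :=
  [/\ unsuccessful k, stepsize r k = alpha_min p
    & stepsize r k.+1 = alpha_min p].

Definition reached k : Prop := forall j, (j < k)%N -> ~ terminates_at j.

Definition polls k : Prop := reached k /\ ~~ search_succeeds k.

(* The value at the starting point is needed as well, and is charged to
   iteration 0; later iterates have been evaluated when they were accepted. *)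
Definition generated_by_algorithm (x0 : 'rV[R]_n) (alpha0 : R) : Prop :=
  [/\ iterate r 0 = x0, stepsize r 0 = alpha0, x0 \in evals r 0
    & forall k, reached k -> (search_step k \/ poll_step k) /\ stepsize_update k].

Definition total_evals k : nat := (\sum_(j < k.+1) size (evals r j))%N.

End Algorithm.

(* Main.v *)
(* Each successful iteration lowers the inexact objective by at least
   c/2 * amin^2, so there are O(1/amin^2) of them.  An unsuccessful iteration that
   does not terminate the run contracts the stepsize, which stays above amin, so
   their number is bounded by a multiple of the number of successful ones plus
   O(alpha0/amin).  At termination no poll direction gives sufficient decrease at
   stepsize amin; the descent lemma for F, the oracle error Lf * acc on each value
   and the cosine measure then give kappa * |grad F| <= (L + c) * amin, where amin
   balances the two error terms. *)

Require Import Defs.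
From HB Require Import structures.
From mathcomp Require Import all_boot all_order all_algebra.
From mathcomp Require Import all_classical all_reals all_analysis.
From mathcomp Require Import ring lra zify.
Import Order.TTheory GRing.Theory Num.Theory.
Import numFieldNormedType.Exports.
Local Open Scope classical_set_scope.
Local Open Scope ring_scope.

Set Implicit Arguments.
Unset Strict Implicit.
Unset Printing Implicit Defensive.

(** * Euclidean inner product and norm *)

Lemma dotvC (R : realType) (n : nat) (u v : 'rV[R]_n) : dotv u v = dotv v u.
Proof. by apply: eq_bigr => i _; rewrite mulrC. Qed.

Lemma dotvDl (R : realType) (n : nat) (u v w : 'rV[R]_n) :
  dotv (u + v) w = dotv u w + dotv v w.
Proof. by rewrite -big_split; apply: eq_bigr => i _; rewrite mxE mulrDl. Qed.

Lemma dotvZl (R : realType) (n : nat) (a : R) (u v : 'rV[R]_n) :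
  dotv (a *: u) v = a * dotv u v.
Proof. by rewrite /dotv mulr_sumr; apply: eq_bigr => i _; rewrite mxE mulrA. Qed.

Lemma dotvNl (R : realType) (n : nat) (u v : 'rV[R]_n) :
  dotv (- u) v = - dotv u v.
Proof. by rewrite -scaleN1r dotvZl mulN1r. Qed.

Lemma dotv_ge0 (R : realType) (n : nat) (u : 'rV[R]_n) : 0 <= dotv u u.
Proof. by apply: sumr_ge0 => i _; rewrite -expr2 sqr_ge0. Qed.

Lemma enorm_sqr (R : realType) (n : nat) (u : 'rV[R]_n) :
  enorm u ^+ 2 = dotv u u.
Proof. by rewrite sqr_sqrtr // dotv_ge0. Qed.

Lemma enorm_ge0 (R : realType) (n : nat) (u : 'rV[R]_n) : 0 <= enorm u.
Proof. exact: sqrtr_ge0. Qed.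

Lemma enorm_gt0 (R : realType) (n : nat) (u : 'rV[R]_n) :
  u != 0 -> 0 < enorm u.
Proof.
move=> u0; rewrite sqrtr_gt0 lt_neqAle dotv_ge0 andbT eq_sym.
apply: contra u0; rewrite psumr_eq0; last by move=> i _; rewrite -expr2 sqr_ge0.
move=> /allP u0; apply/eqP/rowP => i; rewrite mxE.
by have := u0 i (mem_index_enum i); rewrite -expr2 sqrf_eq0 => /eqP.
Qed.

Lemma enormN (R : realType) (n : nat) (u : 'rV[R]_n) : enorm (- u) = enorm u.
Proof. by rewrite /enorm dotvNl dotvC dotvNl opprK. Qed.

Lemma enormZ_unit (R : realType) (n : nat) (a : R) (d : 'rV[R]_n) :
  0 <= a -> enorm d = 1 -> enorm (a *: d) = a.
Proof.
move=> a0 d1; rewrite /enorm dotvZl dotvC dotvZl -enorm_sqr d1.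
by rewrite expr1n mulr1 -expr2 sqrtr_sqr ger0_norm.
Qed.

Lemma dotv_unit_le (R : realType) (n : nat) (u d : 'rV[R]_n) :
  enorm d = 1 -> dotv u d <= enorm u.
Proof.
move=> d1; rewrite (le_trans (ler_norm _))// -ler_sqr ?nnegrE ?enorm_ge0//.
rewrite real_normK ?num_real// enorm_sqr.
(* Cauchy-Schwarz: the part of [u] orthogonal to the unit vector [d] has squared norm
   [dotv u u - dotv u d ^+ 2]. *)
have := dotv_ge0 (u + (- dotv u d) *: d).
rewrite dotvDl !dotvZl (dotvC u) (dotvC d) !dotvDl !dotvZl -(enorm_sqr d) d1.
by rewrite (dotvC d u); lra.
Qed.

(** * Directional derivatives, the descent lemma and the cosine measure *)

Lemma derive_dotv_grad (R : realType) (n : nat) (F : 'rV[R]_n -> R)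
    (x v : 'rV[R]_n) : differentiable F x -> 'D_v F x = dotv (grad F x) v.
Proof.
move=> dF; rewrite deriveE// [in LHS](row_sum_delta v) linear_sum.
by apply: eq_bigr => i _; rewrite linearZ/= mxE deriveE// mulrC.
Qed.

Lemma is_derive_line (R : realType) (n : nat) (F : 'rV[R]_n -> R)
    (x d : 'rV[R]_n) (t : R) : differentiable F (x + t *: d) ->
  is_derive t 1 (fun s : R => F (x + s *: d)) (dotv (grad F (x + t *: d)) d).
Proof.
move=> dF.
have dl : is_diff (t : R) (fun s : R => x + s *: d) ( *:%R^~ d).
  have := is_diffD (is_diff_cst x t) (is_diff_scalel t d).
  by rewrite add0r.
have dFl : is_diff (x + t *: d) F ('d F (x + t *: d)) by apply: DiffDef.
have [dFd dFE] := is_diff_comp dl dFl.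
apply: DeriveDef; first exact/derivable1_diffP.
by rewrite deriveE// dFE/= scale1r -deriveE// derive_dotv_grad.
Qed.

Lemma is_derive_quad (R : realType) (b e t : R) :
  is_derive t 1 (fun s : R => b * s + e * s ^+ 2) (b + 2 * e * t).
Proof.
have := is_deriveD (is_deriveZ b (is_derive_id t 1))
  (is_deriveZ e (is_deriveX 2 (is_derive_id t 1))).
move=> /is_derive_eq; apply; rewrite /GRing.scale/=; ring.
Qed.

Lemma descent_lemma (R : realType) (n : nat) (F : 'rV[R]_n -> R) (L a : R)
    (x d : 'rV[R]_n) :
  (forall x, differentiable F x) ->
  (forall x x', enorm (grad F x - grad F x') <= L * enorm (x - x')) ->
  0 <= a -> enorm d = 1 ->
  F (x + a *: d) <= F x + a * dotv (grad F x) d + L / 2 * a ^+ 2.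
Proof.
move=> dF lipF a0 d1.
(* [phi] is [F] on the segment minus its quadratic model, up to the constant [F x]. Cauchy-Schwarz
   and the Lipschitz gradient make its derivative nonpositive, so the mean value theorem gives
   [phi a <= phi 0]. *)
pose phi (t : R) : R :=
  F (x + t *: d) - (dotv (grad F x) d * t + L / 2 * t ^+ 2).
have dphi (t : R) : is_derive t 1 phi
    (dotv (grad F (x + t *: d)) d - (dotv (grad F x) d + 2 * (L / 2) * t)).
  exact: (is_deriveB (is_derive_line (dF (x + t *: d))) (is_derive_quad _ _ t)).
have cphi : {within `[0, a], continuous phi}.
  apply: derivable_within_continuous => t _.
  by have [] := dphi t.
have [t /itvP t0a] := MVT_segment a0 (fun t _ => dphi t) cphi.
suff : dotv (grad F (x + t *: d)) d - (dotv (grad F x) d + 2 * (L / 2) * t) <= 0.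
  move=> le0 E; have : phi a - phi 0 <= 0 by rewrite E subr0 mulr_le0_ge0.
  by rewrite /phi scale0r addr0; lra.
have := dotv_unit_le (grad F (x + t *: d) - grad F x) d1.
have := lipF (x + t *: d) x.
rewrite addrAC subrr add0r enormZ_unit ?t0a// dotvDl dotvNl.
lra.
Qed.

(* [inf] and [sup] take the value [0] on sets without infimum or supremum, so
   positivity of [kappa] rules these cases out. *)
Lemma le_cosine_measure (R : realType) (n : nat) (D : seq 'rV[R]_n)
    (v : 'rV[R]_n) (kappa B : R) :
  v != 0 -> 0 < kappa -> kappa <= cosine_measure D ->
  (forall d, d \in D -> dotv d v / (enorm d * enorm v) <= B) -> kappa <= B.
Proof.
move=> v0 kappa0; rewrite /cosine_measure; set E := (X in inf X) => kappaE leB.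
have [[_ lbE]|infE] := pselect (has_inf E); last first.
  by move: kappaE; rewrite inf_out// leNgt kappa0.
have : kappa <= sup [set dotv d v / (enorm d * enorm v) | d in [set` D]].
  by apply: (le_trans kappaE); apply: ge_inf => //; exists v.
set S := [set _ | _ in _] => kappaS.
have [[S0 _]|supS] := pselect (has_sup S); last first.
  by move: kappaS; rewrite sup_out// leNgt kappa0.
by apply: (le_trans kappaS); apply: ge_sup => // _ [d /= dD <-]; exact: leB.
Qed.

(** * Counting contractions of the stepsize *)

Lemma exists_expr_mul_le1 (R : realType) (th x : R) : 0 < th < 1 -> 1 <= x ->
  exists j : nat, th ^+ j * x <= 1 /\ j%:R <= ((1 - th)^-1 + 1) * x.
Proof.
move=> /andP[th0 th1] x1; set b := 1 - th.
have b0 : 0 < b by rewrite subr_gt0.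
have th_exp j : 0 <= th ^+ j by rewrite exprn_ge0// ltW.
(* Bernoulli-type bound: [j * b >= x] suffices for [th ^+ j * x <= 1]. The resulting [j] is linear
   in [x], cruder than a logarithm but enough for a final bound quadratic in [alpha0 / amin]. *)
have bern (j : nat) : th ^+ j * (1 + j%:R * b) <= 1.
  elim: j => [|j IHj]; first by rewrite mul0r addr0 mulr1.
  apply: le_trans IHj; rewrite exprSr -mulrA ler_wpM2l//.
  have -> : th = 1 - b by rewrite /b subKr.
  rewrite -natr1; have : 0 <= j%:R * b ^+ 2 + b ^+ 2 :> R.
    by rewrite addr_ge0 ?sqr_ge0// mulr_ge0 ?sqr_ge0.
  lra.
have xb0 := divr_ge0 (le_trans ler01 x1) (ltW b0).
have /andP[tle tgt] := truncn_itv xb0.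
pose j := (Num.trunc (x / b)).+1; exists j; split.
  apply: (le_trans _ (bern j)); rewrite ler_wpM2l//.
  have : x <= j%:R * b by rewrite -ler_pdivrMr// ltW.
  lra.
by rewrite /j -natr1 mulrDl mul1r [_^-1 * x]mulrC lerD.
Qed.

(* The witness [j] bounds the number of further contractions needed to bring
   the stepsize down to [amin]: a contraction lowers it by one and an expansion
   raises it by at most [G]. *)
Lemma count_contractions (R : realType) (a : nat -> R) (succ : pred nat)
    (amin th ga : R) (G p0 K : nat) :
  0 < th < 1 -> 0 < amin -> th ^+ G * ga <= 1 -> a 0%N * th ^+ p0 <= amin ->
  (forall k, (k < K)%N ->
    [/\ 0 <= a k,
        succ k -> a k.+1 <= ga * a k
      & ~~ succ k -> amin < a k /\ a k.+1 = Num.max amin (th * a k)]) ->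
  (K <= p0 + G.+1 * \sum_(k < K) succ k)%N.
Proof.
move=> /andP[th0 th1] amin0 thG ap0 step.
suff [j [_ le_j]] : exists j, a K * th ^+ j <= amin /\
    (j + K <= p0 + G.+1 * \sum_(k < K) succ k)%N.
  by apply: leq_trans le_j; rewrite leq_addl.
have th_exp j : 0 <= th ^+ j by rewrite exprn_ge0// ltW.
elim: K step => [|K IHK] step.
  by exists p0; rewrite big_ord0 muln0.
have [j [aj le_j]] : exists j, a K * th ^+ j <= amin /\
    (j + K <= p0 + G.+1 * \sum_(k < K) succ k)%N.
  by apply: IHK => k kK; apply: step; rewrite ltnW.
have [aK0 sK fK] := step K (ltnSn K).
rewrite big_ord_recr/=; have [sc|fl] := boolP (succ K).
  exists (j + G)%N; split; last first.
    move: le_j; rewrite mulnDr muln1; set T := (_.+1 * \sum_(k < K) _)%N; lia.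
  (* By the choice of [G], [G] contractions undo one expansion by [ga]. *)
  apply: le_trans aj; rewrite exprD [th ^+ j * _]mulrC mulrA.
  rewrite ler_wpM2r//; apply: le_trans (ler_wpM2r (th_exp G) (sK sc)) _.
  by rewrite mulrAC ler_piMl// mulrC.
have [aK ->] := fK fl; rewrite addn0.
(* The case [j = 0] would mean [a K <= amin], against the strict inequality [aK]; hence one
   contraction can be taken off [j]. *)
case: j aj le_j => [|j] aj le_j; first by rewrite expr0 mulr1 leNgt aK in aj.
exists j; rewrite addnS -addSn; split=> //.
have le1 : amin * th ^+ j <= amin by rewrite ger_pMr// exprn_ile1// ltW.
rewrite maxr_pMl// ge_max le1/=.
by rewrite (mulrC th) -mulrA -exprS.
Qed.

(** * Runs of the algorithm: outcomes, termination, gradient at the last iterate *)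

Lemma unsuccessful_not_decreases (R : realType) (n : nat) (p : ds_params R)
    (Ft : 'rV[R]_n -> R) (r : ds_run R n) (k : nat) (d : 'rV[R]_n) :
  unsuccessful p Ft r k -> d \in poll_dirs r k ->
  ~~ decreases p Ft r k (trial r k d).
Proof.
move=> /andP[ss]; rewrite /poll_succeeds ss/= => /hasPn; exact.
Qed.

Lemma step_outcome (R : realType) (n : nat) (p : ds_params R)
    (Ft : 'rV[R]_n -> R) (r : ds_run R n) (k : nat) :
  search_step p Ft r k \/ poll_step p Ft r k ->
  if unsuccessful p Ft r k then iterate r k.+1 = iterate r k
  else decreases p Ft r k (iterate r k.+1).
Proof.
case=> [[ss _ dec _]|[_ _ _ [[d [dD dec -> _]]|[-> ? _]]]] //.
  by rewrite /unsuccessful ss.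
have [/unsuccessful_not_decreases/(_ dD)|//] := boolP (unsuccessful _ _ _ _).
by rewrite dec.
Qed.

Lemma stepsize_ge (R : realType) (n : nat) (p : ds_params R)
    (Ft : 'rV[R]_n -> R) (r : ds_run R n) (x0 : 'rV[R]_n) (alpha0 : R) (k : nat) :
  generated_by_algorithm p Ft r x0 alpha0 -> alpha_min p <= alpha0 ->
  reached p Ft r k -> alpha_min p <= stepsize r k.
Proof.
move=> [_ r0 _ rS] amin_le; elim: k => [|k IHk] rk; first by rewrite r0.
have rk' : reached p Ft r k by move=> j jk; apply: rk; rewrite ltnW.
have [_] := rS k rk'; rewrite /stepsize_update; case: ifP => _.
  by move=> ->; rewrite le_max lexx.
by move=> /andP[+ _]; apply: le_trans; exact: IHk.
Qed.

(** The accepted decreases telescope, and [stepsize_ge] replaces each stepsize by [alpha_min p]. *)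
Lemma sufficient_decrease (R : realType) (n : nat) (p : ds_params R)
    (Ft : 'rV[R]_n -> R) (r : ds_run R n) (x0 : 'rV[R]_n) (alpha0 : R) (k : nat) :
  0 <= dcoef p -> 0 <= alpha_min p ->
  generated_by_algorithm p Ft r x0 alpha0 -> alpha_min p <= alpha0 ->
  reached p Ft r k ->
  Ft (iterate r k) + dcoef p / 2 * alpha_min p ^+ 2
    * (\sum_(j < k) ~~ unsuccessful p Ft r j)%:R <= Ft x0.
Proof.
move=> c0 amin0 gen amin_le; have [i0 _ _ rS] := gen.
elim: k => [|k IHk] rk; first by rewrite big_ord0 mulr0 addr0 i0.
have rk' : reached p Ft r k by move=> j jk; apply: rk; rewrite ltnW.
apply: (le_trans _ (IHk rk')).
have [/step_outcome + _] := rS k rk'.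
rewrite big_ord_recr/= natrD; case: ifP => _; first by move=> ->; rewrite addr0.
rewrite /decreases => dec.
have : dcoef p / 2 * alpha_min p ^+ 2 <= dcoef p / 2 * stepsize r k ^+ 2.
  rewrite ler_wpM2l ?divr_ge0// ler_sqr ?nnegrE//.
    exact: stepsize_ge gen amin_le rk'.
  exact: le_trans amin0 (stepsize_ge gen amin_le rk').
rewrite mulrDr mulr1; lra.
Qed.

(** [count_contractions] bounds [k] through the number of successes, which [sufficient_decrease]
    bounds through the gap [Ft x0 - flow]. *)
Lemma reached_bound (R : realType) (n : nat) (p : ds_params R)
    (Ft : 'rV[R]_n -> R) (r : ds_run R n) (x0 : 'rV[R]_n) (alpha0 flow : R)
    (G p0 k : nat) :
  0 < theta p < 1 -> 0 < dcoef p -> 0 < alpha_min p ->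
  theta p ^+ G * gamma p <= 1 -> theta p ^+ p0 * alpha0 <= alpha_min p ->
  generated_by_algorithm p Ft r x0 alpha0 -> alpha_min p <= alpha0 ->
  (forall x, flow <= Ft x) -> reached p Ft r k ->
  k%:R <= p0%:R + G.+1%:R * (2 * (Ft x0 - flow) / (dcoef p * alpha_min p ^+ 2)).
Proof.
move=> th01 c0 amin0 thG thp0 gen amin_le flow_le rk.
have [_ a0E _ rS] := gen.
have kle : (k <= p0 + G.+1 * \sum_(j < k) ~~ unsuccessful p Ft r j)%N.
  apply: (@count_contractions R (stepsize r)
    (fun j => ~~ unsuccessful p Ft r j) (alpha_min p) (theta p) (gamma p)) => //.
    by rewrite a0E mulrC.
  move=> j jk; have rj : reached p Ft r j.
    by move=> i ij; apply: rk; exact: ltn_trans jk.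
  have aj := stepsize_ge gen amin_le rj; have [_] := rS j rj.
  rewrite /stepsize_update; case: ifP => uj aSj.
    split=> // [|_]; first exact: le_trans (ltW amin0) aj.
    (* An unsuccessful iteration at stepsize [alpha_min p] keeps that stepsize, so it would
       terminate the run at [j < k], contradicting [rk]. *)
    split=> //; rewrite lt_neqAle aj andbT; apply/eqP => ajE.
    apply: (rk j jk); split=> //; rewrite aSj -ajE.
    by apply/max_idPl; rewrite ger_pMl// ltW//; case/andP: th01.
  split=> // [|_]; first exact: le_trans (ltW amin0) aj.
  by case/andP: aSj.
have := sufficient_decrease (ltW c0) (ltW amin0) gen amin_le rk.
move: kle; set S := (\sum_(j < k) _)%N => kle dec.
apply: (@le_trans _ _ (p0%:R + G.+1%:R * S%:R)).
  by rewrite -natrM -natrD ler_nat.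
rewrite lerD2l ler_wpM2l// ler_pdivlMr; last by rewrite mulr_gt0// exprn_gt0.
have := flow_le (iterate r k); lra.
Qed.

(** The least terminating index is reached. Without one, every index would be reached, even those
    beyond [N]. *)
Lemma exists_termination (R : realType) (n : nat) (p : ds_params R)
    (Ft : 'rV[R]_n -> R) (r : ds_run R n) (N : R) :
  (forall k, reached p Ft r k -> k%:R <= N) ->
  exists k, reached p Ft r k /\ terminates_at p Ft r k.
Proof.
move=> leN; have [ex|nex] := pselect (exists k, `[< terminates_at p Ft r k >]).
  exists (ex_minn ex); case: ex_minnP => k /asboolP tk kmin; split=> // j jk tj.
  by have := kmin j (asboolT tj); rewrite leqNgt jk.
have : (Num.trunc N).+1%:R <= N.
  by apply: leN => j _ tj; apply: nex; exists j; exact: asboolT.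
by rewrite leNgt truncnS_gt.
Qed.

(* Passing from [Ft] to [F] costs [2 * e], which for this stepsize equals the
   error [(L + c) / 2 * a ^+ 2] of the exact method. *)
Lemma unsuccessful_grad_le (R : realType) (n : nat) (F Ft : 'rV[R]_n -> R)
    (L c e kappa a : R) (D : seq 'rV[R]_n) (x : 'rV[R]_n) :
  (forall x, differentiable F x) ->
  (forall x x', enorm (grad F x - grad F x') <= L * enorm (x - x')) ->
  (forall x, `|Ft x - F x| <= e) -> 0 < a -> (L + c) * a ^+ 2 = 4 * e ->
  0 < kappa -> kappa <= cosine_measure D ->
  (forall d, d \in D -> enorm d = 1) ->
  (forall d, d \in D -> Ft x - c / 2 * a ^+ 2 <= Ft (x + a *: d)) ->
  kappa * enorm (grad F x) <= (L + c) * a.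
Proof.
move=> dF lipF FtF a0 aE kappa0 kappaD D1 unsucc.
(* The cosine measure only tests nonzero vectors. For a zero gradient the claim is
   [0 <= (L + c) * a], which follows from [aE] and [0 <= e]. *)
have [g0|g0] := eqVneq (grad F x) 0.
  have -> : enorm (grad F x) = 0.
    by apply/eqP; rewrite g0 -sqrf_eq0 enorm_sqr -(scale0r 0) dotvZl mul0r.
  have e0 : 0 <= e by apply: le_trans (FtF x).
  rewrite mulr0 -(pmulr_lge0 _ a0) -mulrA -expr2 aE; exact: mulr_ge0.
have gN0 : 0 < enorm (grad F x) by exact: enorm_gt0.
rewrite -ler_pdivlMr//; apply: (@le_cosine_measure _ _ D (- grad F x)) => //.
  by rewrite oppr_eq0.
move=> d dD; rewrite (D1 d dD) mul1r enormN ler_pM2r ?invr_gt0//.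
rewrite -(ler_pM2r a0) -mulrA -expr2 dotvC dotvNl.
have := descent_lemma x dF lipF (ltW a0) (D1 d dD).
have := unsucc d dD; have := FtF x; have := FtF (x + a *: d).
rewrite !ler_norml => /andP[? ?] /andP[? ?] ? ?.
lra.
Qed.

(** * From iteration counts to evaluation counts *)

Lemma total_evals_le (R : realType) (n : nat) (r : ds_run R n) (k : nat) (b : R) :
  (forall j, (j <= k)%N -> (size (evals r j))%:R <= b) ->
  (total_evals r k)%:R <= k.+1%:R * b.
Proof.
move=> le_b; rewrite /total_evals natr_sum.
apply: (@le_trans _ _ (\sum_(j < k.+1) b)).
  by apply: ler_sum => j _; apply: le_b; rewrite -ltnS.
by rewrite sumr_const card_ord mulr_natl.
Qed.

(* Every term of the iteration bound is [O(amin ^- 2)], since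
   [1 <= x <= x ^+ 2] for [x = alpha0 / amin]. *)
Lemma iteration_bound (R : realFieldType) (K P G B gap Delta c amin alpha0 : R) :
  0 < amin -> amin <= alpha0 -> 0 < c -> 0 <= G -> 0 <= B -> gap <= Delta ->
  P <= B * (alpha0 / amin) ->
  K <= P + G * (2 * gap / (c * amin ^+ 2)) ->
  K + 1 <= (alpha0 ^+ 2 * (B + 1) + G * (2 * `|Delta| / c) + 1) / amin ^+ 2.
Proof.
move=> amin0 amin_le c0 G0 B0 gap_le PB KP; set x := alpha0 / amin in PB.
have x1 : 1 <= x by rewrite ler_pdivlMr// mul1r.
have -> : (alpha0 ^+ 2 * (B + 1) + G * (2 * `|Delta| / c) + 1) / amin ^+ 2 =
    x ^+ 2 * (B + 1) + G * (2 * `|Delta| / (c * amin ^+ 2)) + (amin ^+ 2)^-1.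
  by rewrite /x; field; rewrite !gt_eqF.
have ca0 : 0 < c * amin ^+ 2 by rewrite mulr_gt0// exprn_gt0.
have : G * (2 * gap / (c * amin ^+ 2)) <= G * (2 * `|Delta| / (c * amin ^+ 2)).
  rewrite ler_wpM2l// ler_pM2r ?invr_gt0// ler_pM2l//.
  exact: le_trans gap_le (ler_norm _).
have : B * x <= B * x ^+ 2 by rewrite ler_wpM2l// expr2 ler_peMr// (le_trans ler01).
have : 1 <= x ^+ 2 by rewrite exprn_ege1.
have : 0 <= (amin ^+ 2)^-1 by rewrite invr_ge0 sqr_ge0.
lra.
Qed.

(** [amin ^+ 2] is proportional to [acc], which is at least [tau * eps ^+ 2 * kappa ^+ 2], and
    [kappa ^+ 2 >= d2 ^+ 2 / n]. This gives one of the two factors [n]; the other is the evaluation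
    budget per iteration. *)
Lemma inv_sqr_amin_le (R : rcfType) (l s d2 tau eps kappa acc amin : R) (n : nat) :
  0 < s -> 0 < l -> 0 < d2 -> 0 < tau -> 0 < eps -> 0 < acc -> (0 < n)%N ->
  s * amin ^+ 2 = 4 * (l * acc) ->
  d2 / Num.sqrt n%:R <= kappa -> tau * (eps ^+ 2 * kappa ^+ 2) <= acc ->
  (amin ^+ 2)^-1 <= s / (4 * l * tau * d2 ^+ 2) * (n%:R / eps ^+ 2).
Proof.
move=> s0 l0 d20 tau0 eps0 acc0 n0 aminE kappa_ge acc_ge.
have nR0 : 0 < n%:R :> R by rewrite ltr0n.
have {}kappa_ge : d2 ^+ 2 / n%:R <= kappa ^+ 2.
  rewrite -[in leLHS](@sqr_sqrtr _ n%:R) ?ler0n// -expr_div_n.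
  have ? : 0 <= d2 / Num.sqrt n%:R by rewrite divr_ge0 ?sqrtr_ge0// ltW.
  by rewrite ler_sqr ?nnegrE// (le_trans _ kappa_ge).
have acc_ge' : tau * (eps ^+ 2 * (d2 ^+ 2 / n%:R)) <= acc.
  by apply: le_trans acc_ge; rewrite !ler_wpM2l ?sqr_ge0// ltW.
have -> : amin ^+ 2 = 4 * (l * acc) / s by rewrite -aminE mulrC mulKf// gt_eqF.
have -> : s / (4 * l * tau * d2 ^+ 2) * (n%:R / eps ^+ 2) =
    (4 * (l * (tau * (eps ^+ 2 * (d2 ^+ 2 / n%:R)))) / s)^-1.
  by field; rewrite !gt_eqF.
rewrite lef_pV2 ?posrE ?divr_gt0 ?mulr_gt0 ?exprn_gt0 ?invr_gt0//.
by rewrite ler_pM2r ?invr_gt0// !ler_pM2l.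
Qed.

(* d3 depends only on c, L and Lf.  The constant C of the O(n^2/eps^2) bound
   depends only on c, L, Lf, d1, d2, on the algorithm parameters alpha0, th, ga,
   on a bound Delta for the initial gap, and on a lower bound tau for the ratio
   acc / (eps^2 kappa^2), which is at most 1 by assumption. *)
Theorem corollary3p2 (R : realType) (c L Lf : R)
    (c_gt0 : 0 < c) (L_ge0 : 0 <= L) (Lf_gt0 : 0 < Lf) :
  exists d3 : R, 0 < d3 /\
  forall (d1 d2 alpha0 th ga Delta tau : R),
    0 < d1 -> 0 < d2 -> 0 < th < 1 -> 1 <= ga -> 0 < tau ->
  exists C : R, 0 < C /\
  forall (n m : nat) (f g : 'rV[R]_n * 'rV[R]_m -> R) (Z : set 'rV[R]_m)
    (y yt : 'rV[R]_n -> 'rV[R]_m) (flow acc eps kappa amin : R)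
    (x0 : 'rV[R]_n) (r : ds_run R n),
  let F := fun x => f (x, y x) in
  let Ft := fun x => f (x, yt x) in
  let p := DSParams amin th ga c in
  (0 < n)%N ->
  (* bilevel problem and oracle *)
  continuous f ->
  (forall x, argmin Z (fun z => g (x, z)) = [set y x]) ->
  0 < acc -> (forall x, enorm (yt x - y x) <= acc) ->
  (* assumptions on f and F *)
  (forall x z, flow <= f (x, z)) ->
  (forall x z z', `|f (x, z) - f (x, z')| <= Lf * enorm (z - z')) ->
  (forall x, differentiable F x) -> continuous (grad F) ->
  (forall x x', enorm (grad F x - grad F x') <= L * enorm (x - x')) ->
  (* the run of the algorithm *)
  amin = 2 * Num.sqrt (Lf * acc / (L + c)) -> amin <= alpha0 ->
  generated_by_algorithm p Ft r x0 alpha0 ->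
  Ft x0 - flow <= Delta ->
  (forall k, polls p Ft r k -> forall d, d \in poll_dirs r k -> enorm d = 1) ->
  0 < kappa -> (forall k, polls p Ft r k -> kappa <= cosine_measure (poll_dirs r k)) ->
  0 < eps -> acc <= eps ^+ 2 * kappa ^+ 2 ->
  (forall k, reached p Ft r k -> (size (evals r k))%:R <= d1 * n%:R) ->
  d2 / Num.sqrt n%:R <= kappa ->
  exists kbar : nat,
    [/\ reached p Ft r kbar,
        terminates_at p Ft r kbar,
        enorm (grad F (iterate r kbar)) <= d3 * eps
      & tau * (eps ^+ 2 * kappa ^+ 2) <= acc ->
        (total_evals r kbar)%:R <= C * (n%:R ^+ 2 / eps ^+ 2)].
Proof.
have s0 : 0 < L + c by rewrite ltr_wpDl.
(* [(L + c) * amin] equals [2 * sqrt (Lf * (L + c) * acc)], and [sqrt acc <= eps * kappa]; the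
   factor [kappa] then cancels. *)
exists (2 * Num.sqrt (Lf * (L + c))); split.
  by rewrite mulr_gt0// sqrtr_gt0 mulr_gt0.
move=> d1 d2 alpha0 th ga Delta tau d10 d20 th01 ga1 tau0.
have [G [thG _]] := exists_expr_mul_le1 th01 ga1.
set B := (1 - th)^-1 + 1.
have B0 : 0 <= B by rewrite addr_ge0// invr_ge0 subr_ge0 ltW//; case/andP: th01.
(* [M / amin ^+ 2] will bound the number of iterations, and [Q * n / eps ^+ 2] will bound
   [1 / amin ^+ 2]. The absolute value keeps [M] positive before anything is known about [Delta]. *)
pose M := alpha0 ^+ 2 * (B + 1) + G.+1%:R * (2 * `|Delta| / c) + 1.
pose Q := (L + c) / (4 * Lf * tau * d2 ^+ 2).
have M0 : 0 < M.
  rewrite ltr_wpDl// addr_ge0//.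
    by rewrite mulr_ge0 ?sqr_ge0// addr_ge0.
  by rewrite mulr_ge0// divr_ge0 ?mulr_ge0// ltW.
have Q0 : 0 < Q by rewrite divr_gt0// !mulr_gt0.
exists (M * Q * d1); split; first exact: mulr_gt0 (mulr_gt0 M0 Q0) d10.
move=> n m f g Z y yt flow acc eps kappa amin x0 r F Ft p n0 _ _ acc0 yt_acc.
move=> flow_le lipf dF _ lipF aminE amin_le gen gap_le D1 kappa0 kappaD eps0.
move=> acc_le evals_le kappa_ge.
have amin0 : 0 < amin by rewrite aminE mulr_gt0// sqrtr_gt0 divr_gt0// mulr_gt0.
have saminE : (L + c) * amin ^+ 2 = 4 * (Lf * acc).
  rewrite aminE exprMn sqr_sqrtr ?divr_ge0 ?mulr_ge0 ?ltW//.
  by field; rewrite gt_eqF.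
have FtF x : `|Ft x - F x| <= Lf * acc.
  by apply: le_trans (lipf _ _ _) _; rewrite ler_pM2l.
have x1 : 1 <= alpha0 / amin by rewrite ler_pdivlMr// mul1r.
(* [p0] contractions bring [alpha0] down to [amin]. *)
have [p0 [thp0 p0_le]] := exists_expr_mul_le1 th01 x1.
have {}thp0 : th ^+ p0 * alpha0 <= amin.
  by move: thp0; rewrite mulrA ler_pdivrMr// mul1r.
have kle k : reached p Ft r k -> k%:R <=
    p0%:R + G.+1%:R * (2 * (Ft x0 - flow) / (c * amin ^+ 2)).
  by apply: (reached_bound (p := p) _ c_gt0 amin0 thG thp0 gen amin_le) => // x; exact: flow_le.
have [k [rk tk]] := exists_termination kle; exists k; split=> //.
  have [uk ak _] := tk; have pk : polls p Ft r k.
    by split=> //; case/andP: uk.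
  have kg : kappa * enorm (grad F (iterate r k)) <= (L + c) * amin.
    apply: (@unsuccessful_grad_le _ _ F Ft L c (Lf * acc) kappa amin
      (poll_dirs r k)) => //; [exact: kappaD|exact: D1|move=> d dD].
    by have := unsuccessful_not_decreases uk dD; rewrite -leNgt /trial ak.
  (* Squaring removes the roots, and [saminE] turns [amin ^+ 2] into a multiple of [acc]. *)
  rewrite -(ler_pM2l kappa0) (le_trans kg)// -ler_sqr ?nnegrE; first last.
  - by rewrite !mulr_ge0 ?sqrtr_ge0// ltW.
  - by rewrite mulr_ge0// ltW.
  rewrite !exprMn sqr_sqrtr; last by rewrite mulr_ge0// ltW.
  rewrite expr2 -mulrA saminE.
  have : Lf * (L + c) * acc <= Lf * (L + c) * (eps ^+ 2 * kappa ^+ 2).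
    by rewrite ler_pM2l// mulr_gt0.
  lra.
(* The terminating iteration [k] is also charged, hence [k.+1] iterations. *)
move=> acc_ge; have kM : k.+1%:R <= M / amin ^+ 2.
  rewrite -natr1; apply: (iteration_bound amin0 amin_le c_gt0 _ B0 gap_le p0_le).
    by [].
  exact: kle.
apply: (@le_trans _ _ (k.+1%:R * (d1 * n%:R))).
  apply: total_evals_le => j jk; apply: evals_le => i ij.
  by apply: rk; exact: leq_trans jk.
have {}kM : k.+1%:R <= M * (Q * (n%:R / eps ^+ 2)).
  apply: (le_trans kM); rewrite ler_pM2l//.
  exact: inv_sqr_amin_le saminE kappa_ge acc_ge.
have -> : M * Q * d1 * (n%:R ^+ 2 / eps ^+ 2) =
    M * (Q * (n%:R / eps ^+ 2)) * (d1 * n%:R) by ring.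
by rewrite ler_wpM2r// mulr_ge0// ltW.
Qed.
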